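(* Let $G=(V,E)$ be a connected finite undirected simple graph and let $S\subseteq V$. Then $G$ contains an $S$-odd walk if and only if $|S|$ is even or $G$ is non-bipartite. Furthermore, when it exists, an $S$-odd walk using each edge at most four times can be found.
   Context: A closed walk is a sequence $v_0e_1v_1\cdots e_\ell v_\ell$ with $e_i=\{v_{i-1},v_i\}\in E$ and $v_\ell=v_0$; vertices and edges may be repeated. The visit number of a vertex $v$ is the number of indices $i\in\{1,\dots,\ell\}$ with $v_i=v$. An $S$-odd walk is a closed walk in which every vertex of $S$ has odd visit number and every vertex of $V\setminus S$ has even visit number. *)

(* Defs.v *)
From mathcomp Require Import all_boot.

Set Implicit Arguments.
Unset Strict Implicit.
Unset Printing Implicit Defensive.

Section Graphs.

Variable T : finType.
Implicit Types (e : rel T) (S : {set T}) (v : T) (p : seq T).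

Definition simple_graph e : Prop := symmetric e /\ irreflexive e.

Definition connected_graph e : Prop :=
  0 < #|T| /\ forall x y, connect e x y.

Definition bipartite e : Prop :=
  exists A : {set T}, forall x y, e x y -> (x \in A) != (y \in A).

(* The walk v_0 e_1 v_1 ... e_l v_l is encoded by v_0 and p = [:: v_1; ...; v_l];
   since the graph is simple, the edges e_i = {v_(i-1), v_i} are determined by
   the vertices.  The length l may be 0. *)
Definition closed_walk e v0 p : Prop := path e v0 p /\ last v0 p = v0.

(* The initial vertex v_0 is not counted: the indices range over 1, ..., l. *)
Definition visit_number p v : nat := count_mem v p.

Definition odd_walk e S v0 p : Prop :=
  closed_walk e v0 p /\ forall v, odd (visit_number p v) = (v \in S).

Definition walk_edges v0 p : seq {set T} :=
  pairmap (fun x y => [set x; y]) v0 p.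

Definition edge_multiplicity v0 p x y : nat :=
  count_mem [set x; y] (walk_edges v0 p).

End Graphs.

(* Main.v *)
Require Import Defs.
From mathcomp Require Import all_boot.

(** Start from a closed walk that visits every vertex, uses each edge at most
    twice and has length congruent to |S| mod 2: it is grown, by detours
    x -> y -> x to unvisited neighbours y, from the empty walk if |S| is even
    and from an odd cycle if |S| is odd.  Then go along this walk and, when a
    vertex x is left for the last time, to y say, with the wrong parity, replace
    the step x -> y by x -> y -> x -> y.  Later changes do not affect x, and an
    edge is the last exit of at most one of its ends, so that its multiplicity
    grows by at most 2.  The parity at the final vertex is then correct because
    the visit numbers sum to the length. *)

Section Walks.

Set Implicit Arguments.
Unset Strict Implicit.

Variables (T : finType) (e : rel T).
Implicit Types (x y v : T) (p q : seq T) (E : {set T}) (f : pred T).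

(** * Edge counts, visit counts and lengths of walks *)

Lemma walk_edges_cat x p q :
  walk_edges x (p ++ q) = walk_edges x p ++ walk_edges (last x p) q.
Proof. exact: pairmap_cat. Qed.

Lemma count_walk_edges_notin x p E v :
  v \in E -> v \notin x :: p -> count_mem E (walk_edges x p) = 0.
Proof.
move=> vE; elim: p x => //= y p IHp x.
rewrite inE negb_or => /andP[vx vyp]; rewrite (IHp _ vyp) addn0.
case: eqP => // Exy; move: vE vyp; rewrite -Exy !inE (negbTE vx) /= => /eqP->.
by rewrite eqxx.
Qed.

(** Each traversal of the edge enters one of its two ends and is charged to that visit. *)
Lemma edge_multiplicity_le_visits x y v p :
  edge_multiplicity v p x y <= count_mem x p + count_mem y p.
Proof.
rewrite /edge_multiplicity; elim: p v => //= z p IHp v.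
rewrite addnACA leq_add ?IHp //; case: eqP => // Exy.
have : z \in [set x; y] by rewrite -Exy !inE eqxx orbT.
by rewrite !inE => /orP[] ->; rewrite ?addn1.
Qed.

Lemma sum_visit_number p : \sum_v visit_number p v = size p.
Proof.
rewrite /visit_number; elim: p => [|y p IHp] /=; first by rewrite big1.
rewrite big_split /= IHp (bigD1 y) //= eqxx big1 ?addn0 // => v.
by rewrite eq_sym => /negbTE->.
Qed.

Lemma odd_sum_eq (I : finType) (F G : I -> nat) :
  (forall i, odd (F i) = odd (G i)) -> odd (\sum_i F i) = odd (\sum_i G i).
Proof.
move=> FG; elim/big_ind2: _ => // a b c d.
by rewrite !oddD => -> ->.
Qed.

Lemma sum_mem (S : {set T}) : \sum_v (v \in S : nat) = #|S|.
Proof. by rewrite -sum1_card [RHS]big_mkcond; apply: eq_bigr => v _; case: (v \in S). Qed.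

Lemma odd_size_odd_walk S x p : odd_walk e S x p -> odd (size p) = odd #|S|.
Proof.
case=> _ pS; rewrite -sum_visit_number -sum_mem; apply: odd_sum_eq => v.
by rewrite pS oddb.
Qed.

Lemma odd_visits_last (S : {set T}) x p : odd (size p) = odd #|S| ->
    (forall v, v != x -> odd (visit_number p v) = (v \in S)) ->
  forall v, odd (visit_number p v) = (v \in S).
Proof.
move=> szp pS v; have [->|/pS//] := eqVneq v x.
move: szp; rewrite -sum_visit_number -sum_mem !(bigD1 x (P := predT)) //= !oddD oddb.
suff -> : odd (\sum_(i | i != x) visit_number p i)
    = odd (\sum_(i | i != x) (i \in S : nat)) by move/addIb.
elim/big_ind2: _ => [//|a b c d|i /pS ->]; last by rewrite oddb.
by rewrite !oddD => -> ->.
Qed.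

(** * Parity correction along a walk *)

(** [f] is the parity still owed by the visits after the start, so it varies in the induction on
    [p]. The inclusion of [q] in [x :: p] keeps a vertex left for the last time out of the rest of
    the walk. An edge gains 2 only while both its ends lie in [x :: p]; one end then drops out, so a
    single indicator pays for all gains. *)
Lemma adjust_parities f x p : path e x p -> symmetric e ->
  exists q, [/\ path e x q /\ last x q = last x p, odd (size q) = odd (size p),
    {subset q <= x :: p},
    forall v, v \in x :: p -> v != last x p -> odd (visit_number q v) = f v
    & forall E, count_mem E (walk_edges x q)
        <= count_mem E (walk_edges x p) + (E \subset x :: p).*2].
Proof.
move=> + e_sym; elim: p x f => [|y p IHp] x f /=.
  by exists [::]; split=> // v; rewrite inE => /eqP->; rewrite eqxx.
case/andP=> exy yp.
case: (boolP ((x \notin y :: p) && f x)) => [/andP[xNyp fx] | nfix].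
- have [q [[eq lq] sq subq fq mq]] := IHp y f yp.
  have xNq : x \notin q by apply: contra xNyp => /subq.
  (* The start is not counted, so the detour gives [x] its only visit, as [f x] asks; [y] gains two
     visits, so the tail keeps [f]. *)
  exists (y :: x :: y :: q); split=> /=.
  + by rewrite exy e_sym exy.
  + by rewrite sq negbK.
  + move=> v; rewrite !inE => /or4P[->|->|->|/subq]; rewrite ?orbT //.
    by rewrite inE => ->; rewrite orbT.
  + move=> v; rewrite inE /visit_number /= => vp vl.
    have [vx | vNx] := eqVneq x v.
      rewrite -vx (count_memPn xNq).
      have /negbTE -> : y != x by apply: contra xNyp => /eqP<-; rewrite mem_head.
      by rewrite fx.
    rewrite eq_sym (negbTE vNx) /= in vp.
    rewrite add0n addnA oddD addnn odd_double /=.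
    exact: fq.
  + move=> E; rewrite (setUC [set y]).
    have := mq E; case: (eqVneq [set x; y] E) => [<- | _] /= mqE.
      (* Here the new walk has three traversals, and the bound is one plus 2: since [x] is absent
         from [y :: p], the tails contribute none. *)
      have xE : x \in [set x; y] by rewrite !inE eqxx.
      have -> : [set x; y] \subset [:: x, y & p].
        by apply/subsetP=> v; rewrite !inE => /orP[]->; rewrite ?orbT.
      have yxp := count_walk_edges_notin xE xNyp.
      have sN : [set x; y] \subset y :: p = false.
        by apply: contraNF xNyp => /subsetP->.
      by move: mqE; rewrite yxp sN leqn0 => /eqP->.
    rewrite !add0n (leq_trans mqE) // leq_add2l leq_double.
    case: (boolP (E \subset y :: p)) => // /subsetP sE.
    suff -> : E \subset [:: x, y & p] by [].
    by apply/subsetP=> v /sE vp; rewrite inE vp orbT.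
(* Entering [y] is itself a visit, so the parity owed by the tail is flipped at [y]. If [x] does not
   recur, then [f x] is false and no visit is right. *)
- have [q [[eq lq] sq subq fq mq]] := IHp y (fun v => (y == v) (+) f v) yp.
  exists (y :: q); split=> /=.
  + by rewrite exy.
  + by rewrite sq.
  + move=> v; rewrite inE => /orP[/eqP->|/subq vp]; first by rewrite !inE eqxx orbT.
    by rewrite inE vp orbT.
  + move=> v vp vl; rewrite /visit_number /= oddD oddb.
    have [vyp | vNyp] := boolP (v \in y :: p).
      by rewrite fq // addKb.
    move: vp; rewrite inE (negbTE vNyp) orbF => /eqP vx; subst v.
    have xNq : x \notin q by apply: contra vNyp => /subq.
    rewrite vNyp /= in nfix; rewrite (count_memPn xNq) (negbTE nfix).
    by rewrite addbF; apply: contraNF vNyp => /eqP->; rewrite mem_head.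
  + move=> E; rewrite -addnA leq_add2l (leq_trans (mq E)) // leq_add2l leq_double.
    case: (boolP (E \subset y :: p)) => // /subsetP sE.
    suff -> : E \subset [:: x, y & p] by [].
    by apply/subsetP=> v /sE vp; rewrite inE vp orbT.
Qed.

(** * Extension to a spanning closed walk *)

Lemma crossing_edge (A : pred T) x y : connect e x y -> x \in A -> y \notin A ->
  exists u v, [/\ e u v, u \in A & v \notin A].
Proof.
case/connectP=> p + ->; elim: p x => [|z p IHp] x /= => [_ -> //|].
case/andP=> exz zp xA; have [zA | zNA] := boolP (z \in A); first exact: IHp.
by exists x, z.
Qed.

(** Induction on the number of unvisited vertices: an edge leads from a visited [u] to an unvisited
    [w], and the detour through [w] adds 2 to the length. *)
Lemma spanning_closed_walk x p : symmetric e -> (forall u v, connect e u v) ->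
    closed_walk e x p -> (forall E, count_mem E (walk_edges x p) <= 2) ->
  exists q, [/\ closed_walk e x q, odd (size q) = odd (size p),
    forall v, v \in x :: q & forall E, count_mem E (walk_edges x q) <= 2].
Proof.
move=> e_sym e_conn; have [n] := ubnP #|[predC x :: p]|.
elim: n p => // n IHn p; rewrite ltnS => lepn [ep lp] mp.
have [v vNp | sp] := pickP [predC x :: p]; last first.
  by exists p; split=> // v; have := sp v; rewrite /= => /negbFE.
have [u [w [euw up wNp]]] := crossing_edge (A := mem (x :: p)) (e_conn x v)
  (mem_head _ _) vNp.
case/splitPl: p / up => p1 p2 ul in lepn ep lp mp vNp wNp *.
have memE z : (z \in x :: p1 ++ [:: w, u & p2])
    = (z == w) || (z \in x :: p1 ++ p2).
  have : u \in x :: p1 by rewrite -ul mem_last.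
  rewrite -!cat_cons !mem_cat => up1; rewrite !(in_cons _ p2, in_cons _ (u :: p2)).
  have [->|_] := eqVneq z w; first by rewrite orbT.
  by have [->|_] := eqVneq z u; rewrite ?up1.
move: ep lp; rewrite cat_path last_cat ul => /andP[ep1 ep2] lp.
have [|||q [cq sq spq mq]] := IHn (p1 ++ [:: w, u & p2]).
- apply: leq_trans lepn; apply: proper_card; apply/properP; split.
    by apply/subsetP=> z; apply: contra => zp; rewrite /= memE zp orbT.
  by exists w; rewrite // inE /= memE eqxx.
- by split; rewrite ?last_cat //= cat_path ep1 ul /= euw e_sym euw.
(* Only the edge between [u] and [w] gains; as [w] was unvisited, its multiplicity rises from 0 to
   2. *)
- move=> E; have := mp E; rewrite !walk_edges_cat !count_cat ul /= (setUC [set w]).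
  have [<-|_ //] := eqVneq [set u; w] E.
  have wE : w \in [set u; w] by rewrite !inE eqxx orbT.
  have := count_walk_edges_notin wE wNp.
  by rewrite walk_edges_cat count_cat ul => /eqP; rewrite addn_eq0 => /andP[/eqP-> /eqP->].
by exists q; split=> //; rewrite sq !size_cat /= !addnS /= negbK.
Qed.

(** * Odd cycles and bipartiteness *)

Lemma not_uniq_split (p : seq T) : ~~ uniq p ->
  exists x p1 p2 p3, p = p1 ++ x :: p2 ++ x :: p3.
Proof.
elim: p => //= x p IHp; rewrite negb_and negbK => /orP[|/IHp].
  by case/splitPr=> p2 p3; exists x, [::], p2, p3.
by move=> [y [p1 [p2 [p3 ->]]]]; exists y, (x :: p1), p2, p3.
Qed.

(** A repeated vertex cuts the walk into two shorter closed walks, one of them odd. The list [q]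
    omits the starting occurrence, so the return to the start is no repetition. *)
Lemma odd_cycle x p : closed_walk e x p -> odd (size p) ->
  exists y q, [/\ closed_walk e y q, odd (size q) & uniq q].
Proof.
have [n] := ubnP (size p); elim: n x p => // n IHn x p.
rewrite ltnS => lepn [ep lp] op; have [up | ] := boolP (uniq p).
  by exists x, p.
case/not_uniq_split=> y [p1 [p2 [p3 Dp]]]; subst p.
move: ep lp lepn op; rewrite cat_path /= cat_path /= !last_cat /= last_cat /=.
case/and5P=> ep1 e1 ep2 e2 ep3 lp; rewrite !size_cat /= size_cat /= => lepn.
have [o2 _ | e2s o13] := boolP (odd (size p2).+1).
  apply: (IHn y (rcons p2 y)); rewrite ?size_rcons //.
    by apply: leq_trans lepn; rewrite !addnS !ltnS addnCA leq_addr.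
  by split; rewrite ?last_rcons // rcons_path ep2.
apply: (IHn x (p1 ++ y :: p3)); rewrite ?size_cat /=.
- by apply: leq_trans lepn; rewrite !addnS !ltnS leq_add2l leq_addl.
- by split; rewrite ?last_cat //= cat_path /= ep1 e1.
move: o13 e2s; rewrite !(oddD, oddS) /=.
by case: (odd (size p1)); case: (odd (size p2)); case: (odd (size p3)).
Qed.

(** Colour each vertex by the parity of a chosen walk from [x]. Some edge has ends of equal colour,
    and it closes the two chosen walks to its ends into an odd walk. *)
Lemma odd_closed_walk (x : T) : symmetric e -> (forall u v, connect e u v) ->
  ~ bipartite e -> exists p, closed_walk e x p /\ odd (size p).
Proof.
move=> e_sym e_conn nbip.
have /fin_all_exists2[w ew lw] (v : T) : exists2 p, path e x p & v = last x p.
  exact/connectP.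
pose A := [set v | odd (size (w v))].
have [/existsP[u /existsP[v /andP[euv Auv]]] | ] :=
    boolP [exists u, exists v, e u v && ((u \in A) == (v \in A))].
  (* The second piece lists the vertices of [w v] backwards from [v] to [x] inclusive; its length is
     one more than that of [w v]. *)
  exists (w u ++ rev (belast x (rcons (w v) u))); split.
    split.
      rewrite cat_path ew -lw /=.
      have -> : path e u (rev (belast x (rcons (w v) u)))
          = path e (last x (rcons (w v) u)) (rev (belast x (rcons (w v) u))).
        by rewrite last_rcons.
      rewrite rev_path (eq_path (e' := e)) => [|a b]; last by rewrite e_sym.
      by rewrite rcons_path ew -lw e_sym.
    by rewrite last_cat belast_rcons rev_cons last_rcons.
  move: Auv; rewrite !inE size_cat size_rev size_belast size_rcons oddD oddS.
  by move=> /eqP->; rewrite addbN addbb.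
move=> /existsPn nE; case: nbip; exists A => u v euv.
by have /existsPn/(_ v) := nE u; rewrite euv.
Qed.

(** Every step changes sides, so the side of the last vertex records the parity of the length. *)
Lemma bipartite_closed_walk_even x p :
  bipartite e -> closed_walk e x p -> ~~ odd (size p).
Proof.
case=> A eA [ep lp].
suff lpA : (last x p \in A) = (x \in A) (+) odd (size p).
  by move: lpA; rewrite lp; case: (x \in A); case: (odd _).
elim: p x ep {lp} => [|y p IHp] x /=; first by rewrite addbF.
by case/andP=> /eA; case: (x \in A) => + /IHp->; case: (y \in A); case: (odd _).
Qed.

End Walks.

(** * The equivalence and the bound on multiplicities *)

Theorem theorem3p5 (T : finType) (e : rel T) (S : {set T})
    (he : simple_graph e) (hconn : connected_graph e) :
  ((exists (v0 : T) (p : seq T), odd_walk e S v0 p) <->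
     (~~ odd #|S| \/ ~ bipartite e))
  /\
  ((exists (v0 : T) (p : seq T), odd_walk e S v0 p) ->
     exists (v0 : T) (p : seq T),
       odd_walk e S v0 p /\
       forall x y : T, e x y -> edge_multiplicity v0 p x y <= 4).
Proof.
case: he hconn => e_sym _ [/card_gt0P[x0 _] e_conn].
have necessity : (exists v0 p, odd_walk e S v0 p) -> ~~ odd #|S| \/ ~ bipartite e.
  case=> x [p pS]; have [oS | eS] := boolP (odd #|S|); [right | by left].
  move=> /bipartite_closed_walk_even/(_ pS.1).
  by rewrite (odd_size_odd_walk pS) oS.
suff sufficiency : ~~ odd #|S| \/ ~ bipartite e ->
    exists v0 p, odd_walk e S v0 p /\
      forall x y, e x y -> edge_multiplicity v0 p x y <= 4.
  split; last by move=> /necessity/sufficiency.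
  by split=> [//|/sufficiency[x [p [pS _]]]]; exists x, p.
move=> Sbip.
have [x [p [cp sp mp]]] : exists x p, [/\ closed_walk e x p,
    odd (size p) = odd #|S| & forall E, count_mem E (walk_edges x p) <= 2].
  have [oS | eS] := boolP (odd #|S|); last by exists x0, [::].
  have nbip : ~ bipartite e by case: Sbip; rewrite ?oS.
  have [p0 [cp0 op0]] := odd_closed_walk x0 e_sym e_conn nbip.
  have [x [p [cp op up]]] := odd_cycle cp0 op0.
  exists x, p; split=> // E.
  (* On the cycle each vertex is visited at most once, so a traversed edge is charged to at most two
     visits. *)
  have [/(nthP E)[i ip Ei] | /count_memPn-> //] := boolP (E \in walk_edges x p).
  rewrite size_pairmap in ip.
  rewrite -Ei (nth_pairmap x) //; apply: leq_trans (edge_multiplicity_le_visits _ _ _ _) _.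
  by rewrite !count_uniq_mem // (leq_add (leq_b1 _) (leq_b1 _)).
have [q [[eq lq] sq spq mq]] := spanning_closed_walk e_sym e_conn cp mp.
have [r [[er lr] sr _ fr mr]] := adjust_parities (mem S) eq e_sym.
exists x, r; split.
  split; first by split; rewrite ?lr.
  apply: (odd_visits_last (x := x)); first by rewrite sr sq.
  by move=> v vx; apply: fr; rewrite ?lq.
(* At most 2 from the spanning walk and at most 2 from the parity correction. *)
move=> u v _; apply: leq_trans (mr _) _; apply: (leq_add (mq _)).
by rewrite -[2]/(true.*2) leq_double leq_b1.
Qed.
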